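(* Assume that $2\mu<\nu\alpha^{2}$. (a) If $\beta^{2}(r)>\eta$ for every $r\in[a,b]$, then the equation $f(\zeta(r))=\beta^{2}(r)$ $(r\in[a,b])$ has a unique solution $\overline{\zeta}\in C[a,b]\cap A_{1}$ with $\overline{\zeta}>-\mu$ on $[a,b]$, and for $\overline{v}(r):=r^{-1}\left(\alpha-\beta(r)/(\overline{\zeta}(r)+\mu)\right)$ one has \[ \widehat{\mathcal{P}}(\overline{v})=\min_{v\in\mathcal{L}^{4}}\widehat{\mathcal{P}}(v)=\max_{\zeta\in A_{1},\,\zeta>-\mu}\mathcal{P}^{d}(\zeta)=\mathcal{P}^{d}(\overline{\zeta}). \] (b) If $0<\beta^{2}(r)<\eta$ for every $r\in[a,b]$, then the equation $f(\zeta(r))=\beta^{2}(r)$ $(r\in[a,b])$ has three solutions $\overline{\zeta}_{1},\overline{\zeta}_{2},\overline{\zeta}_{3}\in C[a,b]\cap A_{1}$ with $\overline{\zeta}_{1}>-\mu>\overline{\zeta}_{2}>\rho>\overline{\zeta}_{3}>-\tfrac{1}{2}\nu\alpha^{2}$ on $[a,b]$. Moreover, for $\overline{v}_{i}(r):=r^{-1}\left(\alpha-\beta(r)/(\overline{\zeta}_{i}(r)+\mu)\right)$ $(i\in\{1,2,3\})$, one has \[ \widehat{\mathcal{P}}(\overline{v}_{1})=\min_{v\in\mathcal{L}^{4}}\widehat{\mathcal{P}}(v)=\max_{\zeta\in A_{1},\,\zeta>-\mu}\mathcal{P}^{d}(\zeta)=\mathcal{P}^{d}(\overline{\zeta}_{1}),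 \] \[ \widehat{\mathcal{P}}(\overline{v}_{2})=\min_{\zeta\in A_{1},\,\overline{\zeta}_{3}<\zeta<-\mu}\mathcal{P}^{d}(\zeta)=\mathcal{P}^{d}(\overline{\zeta}_{2}), \] \[ \widehat{\mathcal{P}}(\overline{v}_{3})=\max_{\zeta\in A_{1},\,\zeta<\overline{\zeta}_{2}}\mathcal{P}^{d}(\zeta)=\mathcal{P}^{d}(\overline{\zeta}_{3}). \]
   Context: Let $\alpha,\mu,\nu,\tau_{\theta}>0$ and $0<a<b$ be real numbers. For $r\in[a,b]$ set $\sigma(r):=b^{2}\tau_{\theta}r^{-2}$ and $\beta(r):=\alpha\mu-\sigma(r)$. Put $\rho:=-\tfrac{1}{3}(\mu+\nu\alpha^{2})$, $\eta:=(\nu\alpha^{2}-2\mu)^{3}/(27\nu)$, and $f(\varsigma):=(2\nu^{-1}\varsigma+\alpha^{2})(\mu+\varsigma)^{2}$ for $\varsigma\in\mathbb{R}$. Write $\mathcal{L}^{p}:=\mathcal{L}^{p}(a,b)$ for the usual real Lebesgue space. Define $\widehat{\mathcal{P}}:\mathcal{L}^{4}\to\mathbb{R}$ by \[ \widehat{\mathcal{P}}(v):=2\pi\int_{a}^{b}\left[\tfrac{1}{2}\mu r^{2}v(r)^{2}+\tfrac{1}{2}\nu\left(\tfrac{1}{2}r^{2}v(r)^{2}-\alpha r v(r)\right)^{2}-\sigma(r)\,r\,v(r)\right]r\,dr . \] With the convention $0/0:=0$ (a nonzero number divided by $0$ being infinite, so that membership in $A_1$ forces $\zeta(r)\neq-\mu$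 for a.e. $r$), let \[ A_{1}:=\left\{\zeta\in\mathcal{L}^{2}\;\Big|\;\frac{\beta^{2}}{\zeta+\mu}\in\mathcal{L}^{1}\right\}, \] and define $\mathcal{P}^{d}:A_{1}\to\mathbb{R}$ by \[ \mathcal{P}^{d}(\zeta):=-\pi\int_{a}^{b}\left(\frac{(\sigma(r)+\alpha\zeta(r))^{2}}{\zeta(r)+\mu}+\nu^{-1}\zeta(r)^{2}\right)r\,dr . \] Inequalities between functions such as $\zeta>-\mu$ for elements $\zeta$ of $\mathcal{L}^2$ are understood a.e. on $[a,b]$; ''min'' and ''max'' mean that the infimum/supremum is attained. *)

(* Defs.v *)
From HB Require Import structures.
From mathcomp Require Import all_boot all_order all_algebra.
From mathcomp Require Import all_classical all_reals all_analysis.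

Set Implicit Arguments.
Unset Strict Implicit.
Unset Printing Implicit Defensive.

Import Order.TTheory GRing.Theory Num.Theory.
Import numFieldNormedType.Exports.

Local Open Scope classical_set_scope.
Local Open Scope ring_scope.

Section Defs.
Context {R : realType}.
Implicit Types (alpha mu nu tau a b : R) (v z : R -> R) (S : set R).

Local Notation leb := (@lebesgue_measure R).

Definition sigma_r b tau (r : R) : R := b ^+ 2 * tau / r ^+ 2.

Definition beta_r alpha mu b tau (r : R) : R := alpha * mu - sigma_r b tau r.

Definition rho_cst alpha mu nu : R := - ((mu + nu * alpha ^+ 2) / 3).

Definition eta_cst alpha mu nu : R :=
  (nu * alpha ^+ 2 - 2 * mu) ^+ 3 / (27 * nu).

Definition f_cubic alpha mu nu (s : R) : R :=
  (2 * nu^-1 * s + alpha ^+ 2) * (mu + s) ^+ 2.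

(* Elements of L^p(a, b) are handled through representatives R -> R, whose
   values off [a, b] are irrelevant (v \_ D is 0 off D); the endpoints form a null set. *)
Definition Lp_itv a b (p : R) : set (R -> R) :=
  [set v | (v \_ `[a, b]) \in Lfun leb p%:E].

Definition C_itv a b : set (R -> R) :=
  [set z | {within `[a, b], continuous z}].

(* The order relation z1 < z2 between elements of a Lebesgue space. *)
Definition ae_lt a b z1 z2 : Prop :=
  {ae leb, forall r, r \in `[a, b] -> z1 r < z2 r}.

Definition Phat alpha mu nu tau a b v : R :=
  2 * pi * \int[leb]_(r in `[a, b])
    ((2^-1 * mu * r ^+ 2 * v r ^+ 2
      + 2^-1 * nu * (2^-1 * r ^+ 2 * v r ^+ 2 - alpha * r * v r) ^+ 2
      - sigma_r b tau r * r * v r) * r).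

(* The quotient is taken in \bar R, where 0^-1 = +oo and 0 * +oo = 0, so that
   0 / 0 = 0 and x / 0 = +oo for x > 0. *)
Definition A1 alpha mu tau a b : set (R -> R) :=
  [set z | Lp_itv a b 2 z /\
    leb.-integrable `[a, b]
      (fun r => (beta_r alpha mu b tau r ^+ 2)%:E / (z r + mu)%:E)%E].

Definition Pd alpha mu nu tau a b z : R :=
  - pi * \int[leb]_(r in `[a, b])
    (((sigma_r b tau r + alpha * z r) ^+ 2 / (z r + mu)
      + nu^-1 * z r ^+ 2) * r).

Definition solves alpha mu nu tau a b z : Prop :=
  forall r, r \in `[a, b] -> f_cubic alpha mu nu (z r) = beta_r alpha mu b tau r ^+ 2.

Definition vbar alpha mu b tau z (r : R) : R :=
  r^-1 * (alpha - beta_r alpha mu b tau r / (z r + mu)).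

Definition is_min S (m : R) : Prop := S m /\ lbound S m.
Definition is_max S (m : R) : Prop := S m /\ ubound S m.

End Defs.

(* Main.v *)
Require Import Defs.
From HB Require Import structures.
From mathcomp Require Import all_boot all_order all_algebra.
From mathcomp Require Import all_classical all_reals all_analysis.
From mathcomp Require Import measurable_realfun ring lra.
Import Order.TTheory GRing.Theory Num.Theory.
Import numFieldNormedType.Exports.
Local Open Scope classical_set_scope.
Local Open Scope ring_scope.

(** Every claimed extremum is already one pointwise in [r], so no calculus of
variations is needed beyond integrating pointwise inequalities.

Write [t = r * v r], [s = sigma r] and [beta = alpha * mu - s]. Both functionals
are [2 * pi] times the integral against [r dr] of a density:
[energy_density s t] for the primal one and [dual_density s z] for the dual one.
Completing squares ([duality_gap]) gives
  energy_density s t - dual_density s z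
    = (nu (t^2/2 - alpha t) - z)^2 / (2 nu)
      + (z + mu) (t - alpha + beta / (z + mu))^2 / 2.
At [t = alpha - beta / (z + mu)] the second square vanishes, and the first one
vanishes as well exactly because [f z = beta^2]; hence the primal value at
[vbar z] is the dual value at [z] for every solution [z] of the cubic equation
([energy_critical]). Where [z > - mu] both squares have nonnegative weights, so
a solution above [- mu] gives the global minimum of the primal functional
([weak_duality]).

For the dual functional, if [f z = beta^2] then the difference of two values of
the density factors completely ([dual_sub_critical]):
  dual_density s z - dual_density s x
    = (x - z)^2 (x + 2 z - 3 rho) / (2 nu (x + mu)).
The extremality of [z] is thus decided by the signs of [x + mu] and of
[x + 2 z - 3 rho]. For a solution above [- mu > rho] these are immediate. For the
other two solutions [z3 < rho < z2] one needs [z3 + 2 z2 >= 3 rho] and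
[z2 + 2 z3 <= 3 rho]; both follow by comparing the cubic at [z] and at
[3 rho - 2 z] ([root_reflection]).

The solutions are obtained by composing [beta^2] with the continuous inverses of
[f] on its three intervals of monotonicity, which are separated by its critical
points [rho] and [- mu], where [f] equals [eta] and [0]. A continuous solution
cannot pass from one of these intervals to another, because [beta^2] avoids both
critical values; this shows that there are only three continuous solutions.
When [beta^2 > eta] no solution lies below [- mu] at all. *)

Local Notation leb := lebesgue_measure.

(** * The two densities *)

Definition energy_density {R : realType} (alpha mu nu s t : R) : R :=
  2^-1 * mu * t ^+ 2 + 2^-1 * nu * (2^-1 * t ^+ 2 - alpha * t) ^+ 2 - s * t.

(** Up to sign, half of the integrand of the dual functional; the factor is chosen
so that both functionals are the same multiple of the integral of their density. *)
Definition dual_density {R : realType} (alpha mu nu s z : R) : R :=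
  - 2^-1 * ((s + alpha * z) ^+ 2 / (z + mu) + nu^-1 * z ^+ 2).

(** The quartic term is a multiple of the square of [t^2/2 - alpha t], so it can be
linearized with a multiplier [z]; what remains is quadratic in [t] with leading
coefficient [(z + mu) / 2]. *)
Lemma duality_gap {R : realType} (alpha mu nu s t z : R) :
  nu != 0 -> z + mu != 0 ->
  energy_density alpha mu nu s t - dual_density alpha mu nu s z
  = (2 * nu)^-1 * (nu * (2^-1 * t ^+ 2 - alpha * t) - z) ^+ 2
    + 2^-1 * (z + mu) * (t - alpha + (alpha * mu - s) / (z + mu)) ^+ 2.
Proof.
by move=> nu0 zmu; rewrite /energy_density /dual_density; field; rewrite nu0 zmu.
Qed.

(** The equation [f z = beta^2] says that [w = beta / (z + mu)] satisfies
[w^2 = 2 z / nu + alpha^2], which is what kills the first square of the gap. *)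
Lemma energy_critical {R : realType} (alpha mu nu s z : R) :
  nu != 0 -> z + mu != 0 ->
  f_cubic alpha mu nu z = (alpha * mu - s) ^+ 2 ->
  energy_density alpha mu nu s (alpha - (alpha * mu - s) / (z + mu))
  = dual_density alpha mu nu s z.
Proof.
move=> nu0 zmu fz; apply/eqP; rewrite -subr_eq0 duality_gap//.
set w := (alpha * mu - s) / (z + mu).
have w2 : w ^+ 2 = 2 * nu^-1 * z + alpha ^+ 2.
  rewrite /w expr_div_n -fz /f_cubic [mu + z]addrC mulfK//.
  by rewrite expf_neq0.
have -> : nu * (2^-1 * (alpha - w) ^+ 2 - alpha * (alpha - w)) - z
    = 2^-1 * nu * (w ^+ 2 - alpha ^+ 2) - z by field.
rewrite w2; apply/eqP; field; exact: nu0.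
Qed.

(** A stationary point [z] makes [x = z] a double zero of the difference; the
remaining numerator factor is affine in [x]. This replaces every convexity or
monotonicity argument on the dual density. *)
Lemma dual_sub_critical {R : realType} (alpha mu nu s z x : R) :
  nu != 0 -> z + mu != 0 -> x + mu != 0 ->
  f_cubic alpha mu nu z = (alpha * mu - s) ^+ 2 ->
  dual_density alpha mu nu s z - dual_density alpha mu nu s x
  = (2 * nu)^-1 * ((x - z) ^+ 2 * (x + 2 * z - 3 * rho_cst alpha mu nu))
    / (x + mu).
Proof.
move=> nu0 zmu xmu fz.
have dE y : y + mu != 0 -> dual_density alpha mu nu s y
  = - 2^-1 * (alpha ^+ 2 * (y + mu)
    - 2 * alpha * (alpha * mu - s) + (alpha * mu - s) ^+ 2 / (y + mu)
    + nu^-1 * y ^+ 2).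
  by move=> ymu; rewrite /dual_density; field; rewrite nu0 ymu.
by rewrite !dE// -fz /f_cubic /rho_cst; field; rewrite nu0 zmu xmu.
Qed.

(** * The cubic *)

(** The cofactor is arranged so that each of the two summands has a sign on each
interval of monotonicity. *)
Lemma f_cubic_subE {R : realType} (alpha mu nu x y : R) : nu != 0 ->
  f_cubic alpha mu nu y - f_cubic alpha mu nu x
  = nu^-1 * (y - x)
    * ((x + mu) * (2 * x + y - 3 * rho_cst alpha mu nu)
       + (y + mu) * (2 * y + x - 3 * rho_cst alpha mu nu)).
Proof. by move=> nu0; rewrite /f_cubic /rho_cst; field. Qed.

(** The point [3 rho - 2 z] is where the numerator in [dual_sub_critical] changes sign.
When [nu > 0], the cubic is not larger there than at [z] as long as [z] exceeds
[- nu alpha^2 / 2]. *)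
Lemma f_cubic_reflect {R : realType} (alpha mu nu z : R) : nu != 0 ->
  f_cubic alpha mu nu z
    - f_cubic alpha mu nu (3 * rho_cst alpha mu nu - 2 * z)
  = 9 / nu * (z - rho_cst alpha mu nu) ^+ 2 * (2 * z + nu * alpha ^+ 2).
Proof. by move=> nu0; rewrite /f_cubic /rho_cst; field. Qed.

(** [rho] is a critical point of value [eta], hence a double root here. *)
Lemma eta_sub_f_cubic {R : realType} (alpha mu nu s : R) : nu != 0 ->
  eta_cst alpha mu nu - f_cubic alpha mu nu s
  = nu^-1 * (s - rho_cst alpha mu nu) ^+ 2
    * (nu * alpha ^+ 2 - 2 * mu - 6 * (s + mu)) / 3.
Proof. by move=> nu0; rewrite /eta_cst /f_cubic /rho_cst; field. Qed.

Lemma rho_lt_Nmu {R : realType} {alpha mu nu : R} :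
  2 * mu < nu * alpha ^+ 2 -> rho_cst alpha mu nu < - mu.
Proof. by rewrite /rho_cst => h; lra. Qed.

Lemma rho_gt_edge {R : realType} {alpha mu nu : R} :
  2 * mu < nu * alpha ^+ 2 ->
  - (2^-1 * nu * alpha ^+ 2) < rho_cst alpha mu nu.
Proof. by rewrite /rho_cst => h; lra. Qed.

Lemma f_cubic_inc_right {R : realType} {alpha mu nu : R} :
  0 < nu -> 2 * mu < nu * alpha ^+ 2 ->
  {in [set s | - mu < s] &, {mono f_cubic alpha mu nu : x y / x <= y}}.
Proof.
move=> nu0 h; apply: le_mono_in => x y; rewrite !inE/= => xI yI xy.
have /= ? := rho_lt_Nmu h; rewrite -subr_gt0 f_cubic_subE ?gt_eqF//.
by apply: mulr_gt0; [apply: mulr_gt0; rewrite ?invr_gt0 ?subr_gt0//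
  |apply: addr_gt0; apply: mulr_gt0; lra].
Qed.

Lemma f_cubic_dec_middle {R : realType} {alpha mu nu : R} :
  0 < nu -> 2 * mu < nu * alpha ^+ 2 ->
  {in [set s | rho_cst alpha mu nu < s < - mu] &,
    {mono f_cubic alpha mu nu : x y /~ x <= y}}.
Proof.
move=> nu0 h; apply: le_nmono_in => x y; rewrite !inE/= => xI yI xy.
rewrite -subr_gt0 f_cubic_subE ?gt_eqF// -[ltRHS]mulrA; apply: mulr_gt0.
  by rewrite invr_gt0.
have xneg : (x + mu) * (2 * x + y - 3 * rho_cst alpha mu nu) < 0.
  by rewrite nmulr_rlt0; lra.
have yneg : (y + mu) * (2 * y + x - 3 * rho_cst alpha mu nu) < 0.
  by rewrite nmulr_rlt0; lra.
by rewrite nmulr_rgt0 ?subr_lt0//; lra.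
Qed.

Lemma f_cubic_inc_left {R : realType} {alpha mu nu : R} :
  0 < nu -> 2 * mu < nu * alpha ^+ 2 ->
  {in [set s | s < rho_cst alpha mu nu] &,
    {mono f_cubic alpha mu nu : x y / x <= y}}.
Proof.
move=> nu0 h; apply: le_mono_in => x y; rewrite !inE/= => xI yI xy.
have /= ? := rho_lt_Nmu h; rewrite -subr_gt0 f_cubic_subE ?gt_eqF//.
by apply: mulr_gt0; [apply: mulr_gt0; rewrite ?invr_gt0 ?subr_gt0//
  |apply: addr_gt0; rewrite nmulr_rgt0; lra].
Qed.

Lemma f_cubic_le_eta {R : realType} {alpha mu nu s : R} :
  0 < nu -> 2 * mu < nu * alpha ^+ 2 -> s <= - mu ->
  f_cubic alpha mu nu s <= eta_cst alpha mu nu.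
Proof.
move=> nu0 h smu; rewrite -subr_ge0 eta_sub_f_cubic ?gt_eqF//.
apply: divr_ge0 => //; apply: mulr_ge0; last by lra.
by apply: mulr_ge0; rewrite ?sqr_ge0 ?invr_ge0 ?ltW.
Qed.

Lemma f_cubic_Nmu {R : realType} (alpha mu nu : R) : f_cubic alpha mu nu (- mu) = 0.
Proof. by rewrite /f_cubic subrr expr0n mulr0. Qed.

Lemma f_cubic_rho {R : realType} (alpha mu nu : R) : nu != 0 ->
  f_cubic alpha mu nu (rho_cst alpha mu nu) = eta_cst alpha mu nu.
Proof.
by move=> nu0; apply/esym/eqP; rewrite -subr_eq0 eta_sub_f_cubic// subrr expr0n
  mulr0 !mul0r.
Qed.

Lemma f_cubic_edge {R : realType} (alpha mu nu : R) : nu != 0 ->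
  f_cubic alpha mu nu (- (2^-1 * nu * alpha ^+ 2)) = 0.
Proof. by move=> nu0; rewrite /f_cubic; field. Qed.

(** By [f_cubic_reflect] the value of the cubic at [3 rho - 2 z] is at most its
value at [z], which is also its value at the other root; monotonicity on the side of
the other root then locates that root with respect to [3 rho - 2 z]. *)
Lemma root_reflection {R : realType} {alpha mu nu z2 z3 : R} :
  0 < nu -> 2 * mu < nu * alpha ^+ 2 ->
  rho_cst alpha mu nu < z2 < - mu ->
  - (2^-1 * nu * alpha ^+ 2) < z3 < rho_cst alpha mu nu ->
  f_cubic alpha mu nu z2 = f_cubic alpha mu nu z3 ->
  3 * rho_cst alpha mu nu <= z3 + 2 * z2 /\
  z2 + 2 * z3 <= 3 * rho_cst alpha mu nu.
Proof.
move=> nu0 h z2I z3I f23; set rho := rho_cst _ _ _ in z2I z3I *.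
have reflect_le z : - (2^-1 * nu * alpha ^+ 2) < z ->
    f_cubic alpha mu nu (3 * rho - 2 * z) <= f_cubic alpha mu nu z.
  move=> zI; rewrite -subr_ge0 f_cubic_reflect ?gt_eqF//.
  apply: mulr_ge0; last by lra.
  by apply: mulr_ge0; rewrite ?sqr_ge0 ?divr_ge0 ?ltW.
have := rho_lt_Nmu h; have := rho_gt_edge h; rewrite -/rho => ? ?; split.
  suff : 3 * rho - 2 * z2 <= z3 by lra.
  rewrite -(f_cubic_inc_left nu0 h) ?inE/= -/rho; [|lra|lra].
  by rewrite -f23 reflect_le//; lra.
(* The reflected point may lie beyond [- mu], hence above [z2] for free. *)
have [qmu|qmu] := leP (- mu) (3 * rho - 2 * z3); first by lra.
suff : z2 <= 3 * rho - 2 * z3 by lra.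
rewrite -(f_cubic_dec_middle nu0 h) ?inE/= -/rho; [|lra|lra].
by rewrite f23 reflect_le//; lra.
Qed.

Lemma f_cubic_continuous {R : realType} (alpha mu nu : R) :
  continuous (f_cubic alpha mu nu).
Proof.
by move=> s; rewrite /f_cubic; apply: cvgM; [|apply: cvgM];
  apply: cvgD => //; (try exact: cvg_cst); apply: cvgM => //; exact: cvg_cst.
Qed.

(** * Continuous branches of an implicit equation *)

(** A right inverse of a strictly increasing function is continuous where it is
valued in an open set: [f] maps the ends of a small interval around [Z y0] to
strict bounds around [y0], and monotonicity carries nearby values back inside. *)
Lemma mono_section_continuous {R : realType} {P U : set R} {f Z : R -> R} :
  open P -> open U -> {in P &, {mono f : x y / x <= y}} ->
  (forall y, U y -> P (Z y) /\ f (Z y) = y) ->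
  forall y, U y -> {for y, continuous Z}.
Proof.
move=> oP oU fmono ZP y0 Uy0; apply/cvgrPdist_lt => e e0.
have [PZ fZ] := ZP _ Uy0.
have /nbhs_ballP[d /= d0 dP] : nbhs (Z y0) P by exact: open_nbhs_nbhs.
pose c := Num.min e d / 2.
have c0 : 0 < c by rewrite divr_gt0// lt_min e0 d0.
have cd : c < d.
  by rewrite /c ltr_pdivrMr// (le_lt_trans (y := d)) ?ge_min ?lexx ?orbT//; lra.
have ce : c < e.
  by rewrite /c ltr_pdivrMr// (le_lt_trans (y := e)) ?ge_min ?lexx//; lra.
have PZl : P (Z y0 - c).
  by apply: dP; rewrite /ball/= opprB addrC subrK gtr0_norm.
have PZr : P (Z y0 + c).
  by apply: dP; rewrite /ball/= opprD addNKr normrN gtr0_norm.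
have fmonolt := leW_mono_in fmono.
have fl : f (Z y0 - c) < y0 by rewrite -[ltRHS]fZ fmonolt ?inE//; lra.
have fr : y0 < f (Z y0 + c) by rewrite -[ltLHS]fZ fmonolt ?inE//; lra.
have nbhsU : nbhs y0 U by exact: open_nbhs_nbhs.
near=> y.
have Uy : U y by near: y; exact: nbhsU.
have yl : f (Z y0 - c) < y by near: y; exact: lt_nbhsr.
have yr : y < f (Z y0 + c) by near: y; exact: lt_nbhsl.
have [PZy fZy] := ZP _ Uy.
rewrite -fZy fmonolt ?inE// in yl; rewrite -fZy fmonolt ?inE// in yr.
by clearbody c; rewrite ltr_norml; apply/andP; split; lra.
Unshelve. all: by end_near. Qed.

(** The branch is defined as an inverse of [f] composed with [g], rather than
point by point in [r], so that it is continuous at the ends of the segment for the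
two-sided topology too. *)
Lemma continuous_branch_inc {R : realType} {P U : set R} {f g : R -> R} {a b : R} :
  open P -> open U -> {in P &, {mono f : x y / x <= y}} ->
  (forall y, U y -> exists2 z, P z & f z = y) ->
  (forall r, r \in `[a, b] -> {for r, continuous g} /\ U (g r)) ->
  exists2 z : R -> R, {within `[a, b], continuous z} &
    forall r, r \in `[a, b] -> P (z r) /\ f (z r) = g r.
Proof.
move=> oP oU fmono surj gU.
pose Z y := xget 0 [set z | P z /\ f z = y].
have ZP y : U y -> P (Z y) /\ f (Z y) = y.
  move=> /surj[z Pz fz].
  by apply: (xgetPex 0 (P := [set z | P z /\ f z = y])); exists z.
exists (Z \o g) => [|r /gU[_ /ZP]//].
apply: continuous_in_subspaceT => r; rewrite inE/= => /gU[gr Ugr].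
by apply: continuous_comp => //; exact: (mono_section_continuous oP oU fmono ZP).
Qed.

Lemma continuous_branch_dec {R : realType} {P U : set R} {f g : R -> R} {a b : R} :
  open P -> open U -> {in P &, {mono f : x y /~ x <= y}} ->
  (forall y, U y -> exists2 z, P z & f z = y) ->
  (forall r, r \in `[a, b] -> {for r, continuous g} /\ U (g r)) ->
  exists2 z : R -> R, {within `[a, b], continuous z} &
    forall r, r \in `[a, b] -> P (z r) /\ f (z r) = g r.
Proof.
move=> oP oU fmono surj gU.
(* Reflect the domain, which makes the function increasing. *)
have oNP : open (-%R @^-1` P).
  by apply: open_comp => // x _; exact: opp_continuous.
have Nfmono : {in -%R @^-1` P &, {mono f \o -%R : x y / x <= y}}.
  by move=> x y; rewrite !inE/= => Px Py; rewrite fmono ?inE// lerN2.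
have [|z zc zP] := continuous_branch_inc oNP oU Nfmono _ gU.
  by move=> y /surj[z Pz fz]; exists (- z); rewrite /= opprK.
exists (-%R \o z); last exact: zP.
move=> r; apply: (@continuous_comp (subspace `[a, b]) R R z -%R).
  exact: zc.
exact: opp_continuous.
Qed.

Lemma IVT_open {R : realType} {f : R -> R} {c d y : R} :
  continuous f -> c <= d -> Num.min (f c) (f d) < y < Num.max (f c) (f d) ->
  exists2 z, c < z < d & f z = y.
Proof.
move=> fc cd /andP[yl yr].
have [||z] := @IVT _ f c d y cd; first exact: continuous_subspaceT.
  by rewrite !ltW.
rewrite in_itv/= !le_eqVlt => /andP[/predU1P[<-|cz]].
  move=> _ fcy; exfalso; move: yl yr.
  by rewrite fcy; case: (ltP y (f d)) => *; lra.
move=> /predU1P[->|zd] fzy; last by exists z; rewrite ?cz.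
by exfalso; move: yl yr; rewrite fzy; case: (ltP (f c) y) => *; lra.
Qed.

(** Used with the critical points of the cubic, to confine a continuous solution
to a single interval of monotonicity. *)
Lemma continuous_avoids {R : realType} {z : R -> R} {a b c : R} :
  {within `[a, b], continuous z} -> (forall r, r \in `[a, b] -> z r != c) ->
  (forall r, r \in `[a, b] -> z r < c) \/ (forall r, r \in `[a, b] -> c < z r).
Proof.
move=> zc zNc.
have [[r [rab zr]]|nex] := pselect (exists r, r \in `[a, b] /\ z r < c); last first.
  right=> r rab; rewrite lt_neqAle eq_sym zNc//= leNgt.
  by apply/negP => zr; apply: nex; exists r.
left=> s sab; rewrite ltNge; apply/negP => zs.
have [t tI /eqP] : exists2 t, t \in `[Num.min r s, Num.max r s] & z t = c.
  apply: IVT; first by rewrite ge_min le_max lexx.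
    apply: continuous_subspaceW zc => t /=; move: rab sab; rewrite !in_itv/=.
    by case: (leP r s) => *; lra.
  by case: (leP r s) => ?;
    [case: (ltP (z r) (z s)) => *|case: (ltP (z s) (z r)) => *]; lra.
apply/negP/zNc; move: rab sab tI; rewrite !in_itv/=.
by case: (leP r s) => *; lra.
Qed.

(** * Solutions of the cubic equation *)

Lemma f_cubic_surj_right {R : realType} {alpha mu nu y : R} :
  0 < alpha -> 0 < mu -> 0 < nu -> 0 < y ->
  exists2 z, - mu < z & f_cubic alpha mu nu z = y.
Proof.
move=> alpha0 mu0 nu0 y0.
(* For [s >= 1] the cubic exceeds [alpha^2 s^2 >= alpha^2 s], and the latter is
   [alpha^2 + y] for this choice of [s]. *)
pose s := 1 + y / alpha ^+ 2.
have al2 : 0 < alpha ^+ 2 by rewrite exprn_gt0.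
have s1 : 1 <= s by rewrite /s lerDl divr_ge0// ltW.
have ys : y < alpha ^+ 2 * s.
  by rewrite /s mulrDr mulr1 mulrCA divff ?gt_eqF// mulr1 ltrDr.
have fs : y < f_cubic alpha mu nu s.
  rewrite (lt_le_trans ys)// /f_cubic; apply: ler_pM; rewrite ?ltW//.
  - exact: lt_le_trans s1.
  - by rewrite ltrDr mulr_gt0 ?mulr_gt0 ?invr_gt0//; exact: lt_le_trans s1.
  - by nra.
have [//||z /andP[zmu _] fz] :=
    IVT_open (c := - mu) (d := s) (y := y) (f_cubic_continuous alpha mu nu).
- by lra.
- by rewrite f_cubic_Nmu gt_min lt_max y0 fs orbT.
- by exists z.
Qed.

Lemma f_cubic_surj_middle {R : realType} {alpha mu nu y : R} :
  0 < nu -> 2 * mu < nu * alpha ^+ 2 -> 0 < y < eta_cst alpha mu nu ->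
  exists2 z, rho_cst alpha mu nu < z < - mu & f_cubic alpha mu nu z = y.
Proof.
move=> nu0 h /andP[y0 ye]; apply: IVT_open.
- exact: f_cubic_continuous.
- exact/ltW/rho_lt_Nmu.
- by rewrite f_cubic_Nmu f_cubic_rho ?gt_eqF// gt_min lt_max y0 ye orbT.
Qed.

Lemma f_cubic_surj_left {R : realType} {alpha mu nu y : R} :
  0 < nu -> 2 * mu < nu * alpha ^+ 2 -> 0 < y < eta_cst alpha mu nu ->
  exists2 z, - (2^-1 * nu * alpha ^+ 2) < z < rho_cst alpha mu nu
    & f_cubic alpha mu nu z = y.
Proof.
move=> nu0 h /andP[y0 ye]; apply: IVT_open.
- exact: f_cubic_continuous.
- exact/ltW/rho_gt_edge.
- by rewrite f_cubic_edge ?f_cubic_rho ?gt_eqF// gt_min lt_max y0 ye orbT.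
Qed.

Lemma beta_continuous {R : realType} (alpha mu b tau r : R) : r != 0 ->
  {for r, continuous (beta_r alpha mu b tau)}.
Proof.
move=> r0; apply: cvgB; first exact: cvg_cst.
apply: cvgM; first exact: cvg_cst.
apply: cvgV; [by rewrite expf_neq0 | exact: exprn_continuous].
Qed.

Lemma beta2_continuous {R : realType} {alpha mu tau a b r : R} :
  0 < a -> r \in `[a, b] ->
  {for r, continuous (fun s => beta_r alpha mu b tau s ^+ 2)}.
Proof.
rewrite in_itv/= => a0 /andP[ar _].
have r0 : r != 0 by rewrite gt_eqF// (lt_le_trans a0).
by apply: cvgM; exact: beta_continuous.
Qed.

Lemma right_solution {R : realType} {alpha mu nu tau a b : R} :
  0 < alpha -> 0 < mu -> 0 < nu -> 0 < a -> 2 * mu < nu * alpha ^+ 2 ->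
  (forall r, r \in `[a, b] -> 0 < beta_r alpha mu b tau r ^+ 2) ->
  exists z : R -> R, [/\ {within `[a, b], continuous z},
    solves alpha mu nu tau a b z & forall r, r \in `[a, b] -> - mu < z r].
Proof.
move=> alpha0 mu0 nu0 a0 h b2.
have b2c r : r \in `[a, b] ->
    {for r, continuous (fun s => beta_r alpha mu b tau s ^+ 2)}
    /\ [set y | 0 < y] (beta_r alpha mu b tau r ^+ 2).
  by move=> rab; split; [exact: (beta2_continuous a0 rab) | exact: b2].
have [z zc zP] := continuous_branch_inc
  (@open_gt R (- mu)) (@open_gt R 0) (f_cubic_inc_right nu0 h)
  (fun y => f_cubic_surj_right alpha0 mu0 nu0) b2c.
by exists z; split => // r /zP[].
Qed.

Lemma open_between {R : realType} (c d : R) : open [set s : R | c < s < d].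
Proof.
rewrite (_ : [set _ | _] = [set s | c < s] `&` [set s | s < d]).
  by apply: openI; [exact: open_gt | exact: open_lt].
by apply/seteqP; split=> s /= => [/andP[]|[-> ->]].
Qed.

Lemma middle_solution {R : realType} {alpha mu nu tau a b : R} :
  0 < nu -> 0 < a -> 2 * mu < nu * alpha ^+ 2 ->
  (forall r, r \in `[a, b] ->
    0 < beta_r alpha mu b tau r ^+ 2 < eta_cst alpha mu nu) ->
  exists z : R -> R, [/\ {within `[a, b], continuous z},
    solves alpha mu nu tau a b z &
    forall r, r \in `[a, b] -> rho_cst alpha mu nu < z r < - mu].
Proof.
move=> nu0 a0 h b2.
have b2c r : r \in `[a, b] ->
    {for r, continuous (fun s => beta_r alpha mu b tau s ^+ 2)}
    /\ [set y | 0 < y < eta_cst alpha mu nu] (beta_r alpha mu b tau r ^+ 2).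
  by move=> rab; split; [exact: (beta2_continuous a0 rab) | exact: b2].
have [z zc zP] := continuous_branch_dec
  (@open_between R _ _) (@open_between R 0 (eta_cst alpha mu nu))
  (f_cubic_dec_middle nu0 h)
  (fun y => f_cubic_surj_middle nu0 h) b2c.
by exists z; split => // r /zP[].
Qed.

Lemma left_solution {R : realType} {alpha mu nu tau a b : R} :
  0 < nu -> 0 < a -> 2 * mu < nu * alpha ^+ 2 ->
  (forall r, r \in `[a, b] ->
    0 < beta_r alpha mu b tau r ^+ 2 < eta_cst alpha mu nu) ->
  exists z : R -> R, [/\ {within `[a, b], continuous z},
    solves alpha mu nu tau a b z &
    forall r, r \in `[a, b] ->
      - (2^-1 * nu * alpha ^+ 2) < z r < rho_cst alpha mu nu].
Proof.
move=> nu0 a0 h b2.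
have fmono : {in [set s | - (2^-1 * nu * alpha ^+ 2) < s < rho_cst alpha mu nu] &,
    {mono f_cubic alpha mu nu : x y / x <= y}}.
  move=> x y; rewrite !inE/= => /andP[_ xr] /andP[_ yr].
  by apply: f_cubic_inc_left => //; rewrite inE.
have b2c r : r \in `[a, b] ->
    {for r, continuous (fun s => beta_r alpha mu b tau s ^+ 2)}
    /\ [set y | 0 < y < eta_cst alpha mu nu] (beta_r alpha mu b tau r ^+ 2).
  by move=> rab; split; [exact: (beta2_continuous a0 rab) | exact: b2].
have [z zc zP] := continuous_branch_inc
  (@open_between R _ _) (@open_between R 0 (eta_cst alpha mu nu)) fmono
  (fun y => f_cubic_surj_left nu0 h) b2c.
by exists z; split => // r /zP[].
Qed.

(** The values [0] and [eta] taken by the cubic at [- mu] and [rho] are excluded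
for [beta^2], so a continuous solution stays in one interval of monotonicity, on
which the cubic is injective. *)
Lemma solution_trichotomy {R : realType} {alpha mu nu tau a b : R}
    {z1 z2 z3 z : R -> R} :
  0 < nu -> 2 * mu < nu * alpha ^+ 2 ->
  (forall r, r \in `[a, b] ->
    0 < beta_r alpha mu b tau r ^+ 2 < eta_cst alpha mu nu) ->
  solves alpha mu nu tau a b z1 -> solves alpha mu nu tau a b z2 ->
  solves alpha mu nu tau a b z3 ->
  (forall r, r \in `[a, b] -> - mu < z1 r) ->
  (forall r, r \in `[a, b] -> rho_cst alpha mu nu < z2 r < - mu) ->
  (forall r, r \in `[a, b] -> z3 r < rho_cst alpha mu nu) ->
  {within `[a, b], continuous z} -> solves alpha mu nu tau a b z ->
  [\/ forall r, r \in `[a, b] -> z r = z1 r,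
      forall r, r \in `[a, b] -> z r = z2 r |
      forall r, r \in `[a, b] -> z r = z3 r].
Proof.
move=> nu0 h b2 z1s z2s z3s z1I z2I z3I zc zs.
have zNmu r : r \in `[a, b] -> z r != - mu.
  move=> rab; apply/eqP => zr; have := zs _ rab; have := b2 _ rab.
  by rewrite zr f_cubic_Nmu => /andP[b20 _] fz; rewrite -fz ltxx in b20.
have zNrho r : r \in `[a, b] -> z r != rho_cst alpha mu nu.
  move=> rab; apply/eqP => zr; have := zs _ rab; have := b2 _ rab.
  by rewrite zr f_cubic_rho ?gt_eqF// => /andP[_ b2e] fz; rewrite -fz ltxx in b2e.
have [zmu|zmu] := continuous_avoids zc zNmu; last first.
  apply: Or31 => r rab; apply: (inc_inj_in (f_cubic_inc_right nu0 h)).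
  - by rewrite inE; exact: zmu.
  - by rewrite inE; exact: z1I.
  - by rewrite zs ?z1s.
have [zrho|zrho] := continuous_avoids zc zNrho.
  apply: Or33 => r rab; apply: (inc_inj_in (f_cubic_inc_left nu0 h)).
  - by rewrite inE; exact: zrho.
  - by rewrite inE; exact: z3I.
  - by rewrite zs ?z3s.
apply: Or32 => r rab; apply: (dec_inj_in (f_cubic_dec_middle nu0 h)).
- by rewrite inE/= zrho ?zmu.
- by rewrite inE; exact: z2I.
- by rewrite zs ?z2s.
Qed.

(** * Integrability on a segment *)

(** Extension by [0] commutes with taking a power, provided the exponent is
positive: this is why it is written as a successor. *)
Lemma Lp_itvP {R : realType} (a b : R) (n : nat) (v : R -> R) :
  Lp_itv a b n.+1%:R v <-> measurable_fun `[a, b] v /\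
    leb.-integrable `[a, b] (EFin \o (fun r => `|v r| ^+ n.+1)).
Proof.
have mD : measurable (`[a, b]%classic : set R) by exact: measurable_itv.
have powE r : (`|(v \_ `[a, b]) r| `^ n.+1%:R)%:E
    = ((EFin \o (fun r => `|v r| ^+ n.+1)) \_ `[a, b]) r.
  rewrite powR_mulrn// !patchE; case: ifPn => // _.
  by rewrite normr0 expr0n.
split.
- move=> vL; split.
    move: (vL); rewrite /Lp_itv/= inE => /andP[/[!inE]/= mv _].
    exact/measurable_restrictT.
  apply/integrable_mkcond => //.
  have := Lfun_integrable (ler1n R n.+1) vL.
  by under eq_fun do rewrite powE.
- move=> [mv iv]; rewrite /Lp_itv/= inE; apply/andP; split; rewrite inE/=.
    exact: (measurable_restrictT v mD).1 mv.
  rewrite /finite_norm unlock /Lnorm; apply: poweR_lty.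
  have /integrableP : leb.-integrable setT
      ((EFin \o (fun r => `|v r| ^+ n.+1)) \_ `[a, b]).
    exact: (iffLR (integrable_mkcond (mu := leb) _ mD) iv).
  move=> [_]; apply: le_lt_trans; rewrite le_eqVlt; apply/orP; left; apply/eqP.
  by apply: eq_integral => r _; rewrite -powE /= [in RHS]ger0_norm ?powR_ge0.
Qed.

(** Inversion is continuous off the origin, and a single point is a measurable
set on which any function is measurable. *)
Lemma measurable_inv {R : realType} : measurable_fun setT (@GRing.inv R).
Proof.
rewrite -(setUv [set 0]); apply/measurable_funU => //; first exact: measurableC.
split; first exact: measurable_fun_set1.
apply: subspace_continuous_measurable_fun; first exact: measurableC.
apply: continuous_in_subspaceT => x; rewrite inE/= => /eqP x0.
exact: inv_continuous.
Qed.

(** Both integrals ignore the null set on which the inequality may fail. *)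
Lemma ae_le_Rintegral d (T : measurableType d) {R : realType}
    (mu : {measure set T -> \bar R}) (D : set T) (f g : T -> R) :
  measurable D -> mu.-integrable D (EFin \o f) -> mu.-integrable D (EFin \o g) ->
  {ae mu, forall x, D x -> f x <= g x} ->
  \int[mu]_(x in D) f x <= \int[mu]_(x in D) g x.
Proof.
move=> mD intf intg [N [mN muN fgN]].
rewrite /Rintegral !(negligible_integral mN mD _ muN)//.
have mDN : measurable (D `\` N) by exact: measurableD.
apply: (le_Rintegral mDN).
- exact: integrableS intf.
- exact: integrableS intg.
- by move=> x [Dx Nx]; move/subsetCl : fgN; exact.
Qed.

(** The power [k] is dominated by [1] plus the power [n], and constants are
integrable on a segment. *)
Lemma integrable_expr_le {R : realType} {a b : R} {k n : nat} {v : R -> R} :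
  (k <= n)%N -> measurable_fun `[a, b] v ->
  leb.-integrable `[a, b] (EFin \o (fun r => `|v r| ^+ n)) ->
  leb.-integrable `[a, b] (EFin \o (fun r => v r ^+ k)).
Proof.
move=> kn mv iv.
have mD : measurable (`[a, b]%classic : set R) by exact: measurable_itv.
have i1 : leb.-integrable `[a, b] (EFin \o (cst 1 : R -> R)).
  by apply: continuous_compact_integrable; [exact: segment_compact
    | apply: continuous_subspaceT => ?; exact: cvg_cst].
apply: (le_integrable _ _ _ (integrableD _ iv i1)) => //.
  by apply/measurable_EFinP; exact: measurable_funX.
move=> r _; rewrite /= lee_fin normrX [leRHS]ger0_norm ?addr_ge0//.
have [v1|v1] := leP `|v r| 1.
  by rewrite (le_trans (exprn_ile1 _ _ v1))// lerDr exprn_ge0.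
by rewrite (le_trans (ler_weXn2l (ltW v1) kn))// lerDl.
Qed.

Lemma integrable_continuousM {R : realType} {a b : R} {h f : R -> R} :
  {within `[a, b], continuous h} -> leb.-integrable `[a, b] (EFin \o f) ->
  leb.-integrable `[a, b] (EFin \o (fun r => h r * f r)).
Proof.
move=> hc intf.
have mD : measurable (`[a, b]%classic : set R) by exact: measurable_itv.
suff : leb.-integrable `[a, b] ((EFin \o h) \* (EFin \o f))%E by [].
apply: (integrableMr _ _ _ intf) => //.
  exact: subspace_continuous_measurable_fun.
have /compact_bounded[M [Mreal hM]] : compact (h @` `[a, b]).
  by apply: continuous_compact => //; exact: segment_compact.
by exists M; split => // x Mx y yD; apply: hM => //; exists y.
Qed.

Lemma integrable_monomialM {R : realType} {a b : R} (c : R) (k : nat) {f : R -> R} :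
  leb.-integrable `[a, b] (EFin \o f) ->
  leb.-integrable `[a, b] (EFin \o (fun r => c * r ^+ k * f r)).
Proof.
apply: integrable_continuousM; apply: continuous_subspaceT => r.
by apply: cvgM; [exact: cvg_cst | exact: exprn_continuous].
Qed.

Lemma integrable_add {R : realType} {a b : R} {f g : R -> R} :
  leb.-integrable `[a, b] (EFin \o f) -> leb.-integrable `[a, b] (EFin \o g) ->
  leb.-integrable `[a, b] (EFin \o (fun r => f r + g r)).
Proof. by move=> intf intg; exact: (integrableD _ intf intg). Qed.

(** * The functionals as integrals of the densities *)

Lemma Phat_energyE {R : realType} (alpha mu nu tau a b : R) (v : R -> R) :
  Phat alpha mu nu tau a b v
  = 2 * pi * \int[leb]_(r in `[a, b])
      (energy_density alpha mu nu (sigma_r b tau r) (r * v r) * r).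
Proof.
by congr (_ * _); apply: eq_Rintegral => r _; rewrite /energy_density; ring.
Qed.

(** The density is a polynomial of degree four in [v], whose coefficients, after
multiplication by [r], are monomials in [r]. *)
Lemma energy_integrable {R : realType} {alpha mu nu tau a b : R} {v : R -> R} :
  0 < a -> Lp_itv a b 4 v ->
  leb.-integrable `[a, b]
    (EFin \o (fun r => energy_density alpha mu nu (sigma_r b tau r) (r * v r) * r)).
Proof.
move=> a0 /Lp_itvP[mv v4].
have vk k c j : (k <= 4)%N ->
    leb.-integrable `[a, b] (EFin \o (fun r => c * r ^+ j * v r ^+ k)).
  by move=> k4; apply/integrable_monomialM/(integrable_expr_le k4).
have i2 := vk 2%N (2^-1 * mu + 2^-1 * nu * alpha ^+ 2) 3%N isT.
have i3 := vk 3%N (- (2^-1 * nu * alpha)) 4%N isT.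
have i4 := vk 4%N (2^-1 ^+ 3 * nu) 5%N isT.
have i1 := vk 1%N (- (b ^+ 2 * tau)) 0%N isT.
have := integrable_add (integrable_add i2 i3) (integrable_add i4 i1).
apply: eq_integrable => // r; rewrite inE/= in_itv/= => /andP[ar _].
have r0 : r != 0 by rewrite gt_eqF// (lt_le_trans a0).
by congr EFin; rewrite /energy_density /sigma_r; field.
Qed.

(** The extended-real quotient differs from the real one only where it is
infinite, and there the real one is [0]: in both cases [fine] of the former is the
latter. *)
Lemma A1_integrable {R : realType} {alpha mu tau a b : R} {z : R -> R} :
  A1 alpha mu tau a b z ->
  leb.-integrable `[a, b]
    (EFin \o (fun r => beta_r alpha mu b tau r ^+ 2 / (z r + mu))).
Proof.
move=> [_ iz].
have quotE r : beta_r alpha mu b tau r ^+ 2 / (z r + mu)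
    = fine ((beta_r alpha mu b tau r ^+ 2)%:E / (z r + mu)%:E)%E.
  rewrite inver; case: eqP => [->|_//]; rewrite invr0 mulr0.
  by rewrite muleC mulyr; case: sgrP => _; rewrite ?mul0e ?mul1e ?mulN1e.
have mq := measurable_int _ iz.
apply: le_integrable iz => //.
  apply/measurable_EFinP; rewrite (funext quotE).
  exact: measurableT_comp mq.
move=> r _; rewrite /= quotE.
by case: (_ / _)%E => [s| |]; rewrite /= ?normr0 ?leey.
Qed.

(** Expanding [sigma + alpha z = alpha (z + mu) - beta] leaves only terms in
[z], [z^2] and [beta^2 / (z + mu)], integrable by definition of [A1]. The bounded
function [(z + mu) / (z + mu)] keeps the expansion valid also where
[z = - mu]. *)
Lemma dual_integrable {R : realType} {alpha mu nu tau a b : R} {z : R -> R} :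
  0 < a -> A1 alpha mu tau a b z ->
  leb.-integrable `[a, b]
    (EFin \o (fun r => dual_density alpha mu nu (sigma_r b tau r) (z r) * r)).
Proof.
move=> a0 zA; have iq := A1_integrable zA.
case: (zA) => /Lp_itvP[mz z2] _.
have mD : measurable (`[a, b]%classic : set R) by exact: measurable_itv.
have zk k c j : (k <= 2)%N ->
    leb.-integrable `[a, b] (EFin \o (fun r => c * r ^+ j * z r ^+ k)).
  by move=> k2; apply/integrable_monomialM/(integrable_expr_le k2).
pose u r := (z r + mu) / (z r + mu).
have iu : leb.-integrable `[a, b] (EFin \o u).
  apply: measurable_bounded_integrable => //.
  - by apply: compact_finite_measure; exact: segment_compact.
  - have mzmu : measurable_fun `[a, b] (fun r => z r + mu).
      exact: measurable_funD.
    by apply: measurable_funM => //; exact: measurableT_comp measurable_inv mzmu.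
  - exists 1; split => // M M1 r _ /=; rewrite /u.
    have [->|zmu] := eqVneq (z r + mu) 0.
      by rewrite mul0r normr0 ltW// (lt_trans _ M1).
    by rewrite divff// normr1 ltW.
have i1 := zk 1%N (- 2^-1 * alpha ^+ 2) 1%N isT.
have i2 := zk 2%N (- 2^-1 * nu^-1) 1%N isT.
have i0 := zk 0%N (- 2^-1 * alpha ^+ 2 * mu) 1%N isT.
have iq' := integrable_monomialM (- 2^-1) 1 iq.
have iu' : leb.-integrable `[a, b]
    (EFin \o (fun r => alpha * (beta_r alpha mu b tau r * r) * u r)).
  apply: integrable_continuousM iu; apply: continuous_in_subspaceT => r.
  rewrite inE/= in_itv/= => /andP[ar _].
  apply: cvgM; first exact: cvg_cst.
  apply: cvgM => //; apply: beta_continuous.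
  by rewrite gt_eqF// (lt_le_trans a0).
have := integrable_add (integrable_add (integrable_add i2 i0)
  (integrable_add iq' i1)) iu'.
apply: eq_integrable => // r _ /=; congr EFin.
rewrite /dual_density /u /beta_r; move: nu^-1 => n.
have [zmu|zmu] := eqVneq (z r + mu) 0.
  by rewrite zmu invr0 (_ : z r = - mu); [ring | lra].
by field.
Qed.

Lemma Pd_dualE {R : realType} {alpha mu nu tau a b : R} {z : R -> R} :
  0 < a -> A1 alpha mu tau a b z ->
  Pd alpha mu nu tau a b z
  = 2 * pi * \int[leb]_(r in `[a, b])
      (dual_density alpha mu nu (sigma_r b tau r) (z r) * r).
Proof.
move=> a0 zA; rewrite /Pd.
under eq_Rintegral => r _.
  have -> : ((sigma_r b tau r + alpha * z r) ^+ 2 / (z r + mu) + nu^-1 * z r ^+ 2) * r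
    = - 2 * (dual_density alpha mu nu (sigma_r b tau r) (z r) * r).
    by rewrite /dual_density; move: nu^-1 (z r + mu)^-1 => n q; field.
  over.
rewrite RintegralZl//; last exact: dual_integrable.
by ring.
Qed.

Lemma within_continuous_div {R : realType} {A : set R} {f g : R -> R} :
  {within A, continuous f} -> {within A, continuous g} ->
  (forall r, A r -> g r != 0) -> {within A, continuous (fun r => f r / g r)}.
Proof.
move=> fc gc g0; rewrite continuous_subspace_in => r /set_mem Ar.
by apply: cvgM; [exact: fc | apply: cvgV; [exact: g0 | exact: gc]].
Qed.

Lemma beta_within_continuous {R : realType} {alpha mu tau a b : R} :
  0 < a -> {within `[a, b], continuous (beta_r alpha mu b tau)}.
Proof.
move=> a0; apply: continuous_in_subspaceT => r; rewrite inE/= in_itv/= => /andP[ar _].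
by apply: beta_continuous; rewrite gt_eqF// (lt_le_trans a0).
Qed.

Lemma Lp_continuous {R : realType} {a b : R} (n : nat) {v : R -> R} :
  {within `[a, b], continuous v} -> Lp_itv a b n.+1%:R v.
Proof.
move=> vc; apply/Lp_itvP; split; first exact: subspace_continuous_measurable_fun.
apply: continuous_compact_integrable; first exact: segment_compact.
move=> r; apply: (@continuous_comp (subspace `[a, b]) R R v (fun x => `|x| ^+ n.+1)).
  exact: vc.
apply: (@continuous_comp R R R Num.norm (fun x => x ^+ n.+1)).
  exact: norm_continuous.
exact: exprn_continuous.
Qed.

Lemma A1_continuous {R : realType} {alpha mu tau a b : R} {z : R -> R} :
  0 < a -> {within `[a, b], continuous z} ->
  (forall r, r \in `[a, b] -> z r + mu != 0) -> A1 alpha mu tau a b z.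
Proof.
move=> a0 zc zmu; split; first exact: Lp_continuous.
have zmuc : {within `[a, b], continuous (fun r => z r + mu)}.
  by move=> r; apply: cvgD; [exact: zc | exact: cvg_cst].
have betac : {within `[a, b], continuous (beta_r alpha mu b tau)}.
  exact: beta_within_continuous.
have b2c : {within `[a, b], continuous (fun r => beta_r alpha mu b tau r ^+ 2)}.
  by move=> r; apply: cvgM; exact: betac.
have := continuous_compact_integrable (@segment_compact R a b)
  (within_continuous_div b2c zmuc zmu).
apply: eq_integrable => // r; rewrite inE/= => rab.
by rewrite inver (negbTE (zmu _ rab)).
Qed.

Lemma vbar_L4 {R : realType} {alpha mu tau a b : R} {z : R -> R} :
  0 < a -> {within `[a, b], continuous z} ->
  (forall r, r \in `[a, b] -> z r + mu != 0) ->
  Lp_itv a b 4 (vbar alpha mu b tau z).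
Proof.
move=> a0 zc zmu; apply: Lp_continuous => r.
have zmuc : {within `[a, b], continuous (fun r => z r + mu)}.
  by move=> s; apply: cvgD; [exact: zc | exact: cvg_cst].
have qc := within_continuous_div (beta_within_continuous a0) zmuc zmu.
have invc : {within `[a, b], continuous (@GRing.inv R)}.
  apply: continuous_in_subspaceT => s; rewrite inE/= in_itv/= => /andP[as_ _].
  by apply: inv_continuous; rewrite gt_eqF// (lt_le_trans a0).
by apply: cvgM; [exact: invc | apply: cvgB; [exact: cvg_cst | exact: qc]].
Qed.

(** * Duality between the functionals *)

(** Integral form of [energy_critical]; it holds on each of the three
branches. *)
Lemma critical_value {R : realType} {alpha mu nu tau a b : R} {z : R -> R} :
  0 < a -> nu != 0 -> A1 alpha mu tau a b z ->
  (forall r, r \in `[a, b] -> z r + mu != 0) -> solves alpha mu nu tau a b z ->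
  Phat alpha mu nu tau a b (vbar alpha mu b tau z) = Pd alpha mu nu tau a b z.
Proof.
move=> a0 nu0 zA zmu zs; rewrite Phat_energyE (Pd_dualE a0 zA); congr (_ * _).
apply: eq_Rintegral => r; rewrite inE/= => rab; congr (_ * _).
have r0 : r != 0.
  by move: rab; rewrite in_itv/= => /andP[ar _]; rewrite gt_eqF// (lt_le_trans a0).
rewrite /vbar mulVKf//; apply: energy_critical => //; first exact: zmu.
exact: zs.
Qed.

Lemma Pd_le {R : realType} {alpha mu nu tau a b : R} {z w : R -> R} :
  0 < a -> A1 alpha mu tau a b z -> A1 alpha mu tau a b w ->
  {ae leb, forall r : R, r \in `[a, b] ->
    dual_density alpha mu nu (sigma_r b tau r) (z r)
    <= dual_density alpha mu nu (sigma_r b tau r) (w r)} ->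
  Pd alpha mu nu tau a b z <= Pd alpha mu nu tau a b w.
Proof.
move=> a0 zA wA zw; rewrite !(Pd_dualE a0)// ler_pM2l; last first.
  by rewrite mulr_gt0// pi_gt0.
apply: ae_le_Rintegral => //; [exact: dual_integrable..|].
apply: (@filterS _ _ (ae_filter_ringOfSetsType leb) _ _ _ zw) => r zwr rab.
rewrite ler_wpM2r ?zwr//.
by move: rab; rewrite /= in_itv/= => /andP[ar _]; rewrite ltW// (lt_le_trans a0).
Qed.

(** Above [- mu] both weights in [duality_gap] are nonnegative. *)
Lemma weak_duality {R : realType} {alpha mu nu tau a b : R} {z v : R -> R} :
  0 < a -> 0 < nu -> A1 alpha mu tau a b z -> Lp_itv a b 4 v ->
  (forall r, r \in `[a, b] -> - mu < z r) ->
  Pd alpha mu nu tau a b z <= Phat alpha mu nu tau a b v.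
Proof.
move=> a0 nu0 zA v4 zmu; rewrite (Pd_dualE a0)// Phat_energyE ler_pM2l; last first.
  by rewrite mulr_gt0// pi_gt0.
apply: le_Rintegral => //; [exact: dual_integrable|exact: energy_integrable|].
move=> r /= rab; rewrite ler_wpM2r//.
  by move: rab; rewrite in_itv/= => /andP[ar _]; rewrite ltW// (lt_le_trans a0).
have zmu0 : 0 < z r + mu by have := zmu _ rab; lra.
rewrite -subr_ge0 duality_gap ?gt_eqF//.
by rewrite addr_ge0// mulr_ge0 ?sqr_ge0 ?mulr_ge0 ?invr_ge0 ?ltW// mulr_gt0.
Qed.

(** * Extremality of the three branches *)

(** In [dual_sub_critical], [x + 2 z - 3 rho] and [x + mu] are both positive, since
[x] and [z] exceed [- mu > rho]. *)
Lemma global_branch {R : realType} {alpha mu nu tau a b : R} {z : R -> R} :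
  0 < a -> 0 < nu -> 2 * mu < nu * alpha ^+ 2 ->
  {within `[a, b], continuous z} -> solves alpha mu nu tau a b z ->
  (forall r, r \in `[a, b] -> - mu < z r) ->
  [/\ Lp_itv a b 4 (vbar alpha mu b tau z),
      is_min (Phat alpha mu nu tau a b @` Lp_itv a b 4)
        (Phat alpha mu nu tau a b (vbar alpha mu b tau z)),
      is_max (Pd alpha mu nu tau a b @`
          [set w | A1 alpha mu tau a b w /\ ae_lt a b (cst (- mu)) w])
        (Phat alpha mu nu tau a b (vbar alpha mu b tau z)) &
      Phat alpha mu nu tau a b (vbar alpha mu b tau z)
        = Pd alpha mu nu tau a b z].
Proof.
move=> a0 nu0 h zc zs zmu.
have zmu0 r : r \in `[a, b] -> z r + mu != 0.
  by move=> /zmu ?; rewrite gt_eqF//; lra.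
have zA : A1 alpha mu tau a b z by exact: A1_continuous.
have vL := vbar_L4 a0 zc zmu0.
have veq := critical_value a0 (lt0r_neq0 nu0) zA zmu0 zs.
split => //.
- split; first by exists (vbar alpha mu b tau z).
  by move=> _ [v v4 <-]; rewrite veq; exact: weak_duality.
rewrite veq; split.
  by exists z => //; split=> //; apply: aeW => r rab; exact: zmu.
move=> _ [w [wA wmu] <-]; apply: (Pd_le a0) => //.
apply: (@filterS _ _ (ae_filter_ringOfSetsType leb) _ _ _ wmu) => r wr rab.
have {wr} wr : 0 < w r + mu by have := wr rab; rewrite /cst; lra.
have zr := zmu _ rab; have rho_mu := rho_lt_Nmu h.
rewrite -subr_ge0 dual_sub_critical ?gt_eqF//; [|lra|exact: zs].
apply: divr_ge0; last exact: ltW.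
by apply: mulr_ge0; [rewrite invr_ge0 mulr_ge0 ?ltW|
  apply: mulr_ge0; [exact: sqr_ge0|lra]].
Qed.

(** For [z3 < x < - mu] the factor [x + 2 z2 - 3 rho] is positive by
[root_reflection] while [x + mu] is negative. *)
Lemma middle_branch {R : realType} {alpha mu nu tau a b : R} {z2 z3 : R -> R} :
  0 < a -> 0 < nu -> 2 * mu < nu * alpha ^+ 2 ->
  {within `[a, b], continuous z2} -> solves alpha mu nu tau a b z2 ->
  solves alpha mu nu tau a b z3 ->
  (forall r, r \in `[a, b] -> rho_cst alpha mu nu < z2 r < - mu) ->
  (forall r, r \in `[a, b] ->
    - (2^-1 * nu * alpha ^+ 2) < z3 r < rho_cst alpha mu nu) ->
  is_min (Pd alpha mu nu tau a b @`
      [set z | [/\ A1 alpha mu tau a b z, ae_lt a b z3 z &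
                   ae_lt a b z (cst (- mu))]])
    (Phat alpha mu nu tau a b (vbar alpha mu b tau z2))
  /\ Phat alpha mu nu tau a b (vbar alpha mu b tau z2)
     = Pd alpha mu nu tau a b z2.
Proof.
move=> a0 nu0 h z2c z2s z3s z2I z3I.
have z2mu0 r : r \in `[a, b] -> z2 r + mu != 0.
  by move=> /z2I ?; rewrite lt_eqF//; lra.
have z2A : A1 alpha mu tau a b z2 by exact: A1_continuous.
rewrite (critical_value a0 (lt0r_neq0 nu0) z2A z2mu0 z2s); split=> //; split.
  exists z2 => //; split=> //; apply: aeW => r rab.
    by have := z2I _ rab; have := z3I _ rab; lra.
  by have := z2I _ rab; rewrite /cst; lra.
move=> _ [w [wA z3w wmu] <-]; apply: (Pd_le a0) => //.
apply: (@filterS2 _ _ (ae_filter_ringOfSetsType leb) _ _ _ _ z3w wmu).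
move=> r z3r wr rab; have {}z3r := z3r rab.
have {wr} wr : w r + mu < 0 by have := wr rab; rewrite /cst; lra.
have [refl _] : _ /\ _ := root_reflection nu0 h (z2I _ rab) (z3I _ rab)
  (etrans (z2s _ rab) (esym (z3s _ rab))).
rewrite -subr_le0 dual_sub_critical ?z2mu0 ?(lt0r_neq0 nu0) ?(ltr0_neq0 wr)//; last first.
  exact: z2s.
apply: mulr_ge0_le0; last by rewrite invr_le0 ltW.
by apply: mulr_ge0; [rewrite invr_ge0 mulr_ge0 ?ltW|
  apply: mulr_ge0; [exact: sqr_ge0|lra]].
Qed.

(** For [x < z2] the factor [x + 2 z3 - 3 rho] is negative by [root_reflection],
and so is [x + mu]. *)
Lemma left_branch {R : realType} {alpha mu nu tau a b : R} {z2 z3 : R -> R} :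
  0 < a -> 0 < nu -> 2 * mu < nu * alpha ^+ 2 ->
  {within `[a, b], continuous z3} -> solves alpha mu nu tau a b z2 ->
  solves alpha mu nu tau a b z3 ->
  (forall r, r \in `[a, b] -> rho_cst alpha mu nu < z2 r < - mu) ->
  (forall r, r \in `[a, b] ->
    - (2^-1 * nu * alpha ^+ 2) < z3 r < rho_cst alpha mu nu) ->
  is_max (Pd alpha mu nu tau a b @`
      [set z | A1 alpha mu tau a b z /\ ae_lt a b z z2])
    (Phat alpha mu nu tau a b (vbar alpha mu b tau z3))
  /\ Phat alpha mu nu tau a b (vbar alpha mu b tau z3)
     = Pd alpha mu nu tau a b z3.
Proof.
move=> a0 nu0 h z3c z2s z3s z2I z3I; have rho_mu := rho_lt_Nmu h.
have z3mu0 r : r \in `[a, b] -> z3 r + mu != 0.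
  by move=> /z3I ?; rewrite lt_eqF//; lra.
have z3A : A1 alpha mu tau a b z3 by exact: A1_continuous.
rewrite (critical_value a0 (lt0r_neq0 nu0) z3A z3mu0 z3s); split=> //; split.
  exists z3 => //; split=> //; apply: aeW => r rab.
  by have := z2I _ rab; have := z3I _ rab; lra.
move=> _ [w [wA wz2] <-]; apply: (Pd_le a0) => //.
apply: (@filterS _ _ (ae_filter_ringOfSetsType leb) _ _ _ wz2).
move=> r wr rab; have {}wr := wr rab; have z2r := z2I _ rab.
have [_ refl] : _ /\ _ := root_reflection nu0 h z2r (z3I _ rab)
  (etrans (z2s _ rab) (esym (z3s _ rab))).
have wmu : w r + mu < 0 by lra.
rewrite -subr_ge0 dual_sub_critical ?z3mu0 ?(lt0r_neq0 nu0) ?(ltr0_neq0 wmu)//; last first.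
  exact: z3s.
apply: mulr_le0; last by rewrite invr_le0 ltW.
apply: mulr_ge0_le0; first by rewrite invr_ge0 mulr_ge0 ?ltW.
by apply: mulr_ge0_le0; [exact: sqr_ge0|lra].
Qed.

(** * The two regimes of [beta^2] *)

Theorem proposition4 (R : realType) (alpha mu nu tau a b : R)
    (halpha : 0 < alpha) (hmu : 0 < mu) (hnu : 0 < nu) (htau : 0 < tau)
    (ha : 0 < a) (hab : a < b)
    (hmunu : 2 * mu < nu * alpha ^+ 2) :
  ((forall r, r \in `[a, b] ->
      eta_cst alpha mu nu < beta_r alpha mu b tau r ^+ 2) ->
   exists zb : R -> R,
     [/\ C_itv a b zb /\ A1 alpha mu tau a b zb,
         solves alpha mu nu tau a b zb,
         forall r, r \in `[a, b] -> - mu < zb r &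
         forall z, C_itv a b z -> A1 alpha mu tau a b z ->
           solves alpha mu nu tau a b z ->
           forall r, r \in `[a, b] -> z r = zb r]
     /\
     [/\ Lp_itv a b 4 (vbar alpha mu b tau zb),
         is_min (Phat alpha mu nu tau a b @` Lp_itv a b 4)
           (Phat alpha mu nu tau a b (vbar alpha mu b tau zb)),
         is_max (Pd alpha mu nu tau a b @`
             [set z | A1 alpha mu tau a b z /\ ae_lt a b (cst (- mu)) z])
           (Phat alpha mu nu tau a b (vbar alpha mu b tau zb)) &
         Phat alpha mu nu tau a b (vbar alpha mu b tau zb)
           = Pd alpha mu nu tau a b zb])
  /\
  ((forall r, r \in `[a, b] ->
      0 < beta_r alpha mu b tau r ^+ 2 < eta_cst alpha mu nu) ->
   exists z1 z2 z3 : R -> R,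
     [/\ [/\ C_itv a b z1 /\ A1 alpha mu tau a b z1,
             C_itv a b z2 /\ A1 alpha mu tau a b z2 &
             C_itv a b z3 /\ A1 alpha mu tau a b z3],
         [/\ solves alpha mu nu tau a b z1,
             solves alpha mu nu tau a b z2 &
             solves alpha mu nu tau a b z3],
         forall r, r \in `[a, b] ->
           [/\ - mu < z1 r, z2 r < - mu, rho_cst alpha mu nu < z2 r,
               z3 r < rho_cst alpha mu nu &
               - (2^-1 * nu * alpha ^+ 2) < z3 r] &
         forall z, C_itv a b z -> A1 alpha mu tau a b z ->
           solves alpha mu nu tau a b z ->
           [\/ forall r, r \in `[a, b] -> z r = z1 r,
               forall r, r \in `[a, b] -> z r = z2 r |
               forall r, r \in `[a, b] -> z r = z3 r]]
     /\
     [/\ [/\ Lp_itv a b 4 (vbar alpha mu b tau z1),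
             Lp_itv a b 4 (vbar alpha mu b tau z2) &
             Lp_itv a b 4 (vbar alpha mu b tau z3)],
         [/\ is_min (Phat alpha mu nu tau a b @` Lp_itv a b 4)
               (Phat alpha mu nu tau a b (vbar alpha mu b tau z1)),
             is_max (Pd alpha mu nu tau a b @`
                 [set z | A1 alpha mu tau a b z /\ ae_lt a b (cst (- mu)) z])
               (Phat alpha mu nu tau a b (vbar alpha mu b tau z1)) &
             Phat alpha mu nu tau a b (vbar alpha mu b tau z1)
               = Pd alpha mu nu tau a b z1],
         is_min (Pd alpha mu nu tau a b @`
             [set z | [/\ A1 alpha mu tau a b z, ae_lt a b z3 z &
                          ae_lt a b z (cst (- mu))]])
           (Phat alpha mu nu tau a b (vbar alpha mu b tau z2))
         /\ Phat alpha mu nu tau a b (vbar alpha mu b tau z2)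
            = Pd alpha mu nu tau a b z2 &
         is_max (Pd alpha mu nu tau a b @`
             [set z | A1 alpha mu tau a b z /\ ae_lt a b z z2])
           (Phat alpha mu nu tau a b (vbar alpha mu b tau z3))
         /\ Phat alpha mu nu tau a b (vbar alpha mu b tau z3)
            = Pd alpha mu nu tau a b z3]).
Proof.
have rho_mu := rho_lt_Nmu hmunu.
have eta0 : 0 < eta_cst alpha mu nu.
  by apply: divr_gt0; [rewrite exprn_gt0// subr_gt0 | rewrite mulr_gt0].
split=> b2.
- have b20 r : r \in `[a, b] -> 0 < beta_r alpha mu b tau r ^+ 2.
    by move=> /b2; exact: lt_trans.
  have [z [zc zs zmu]] := right_solution halpha hmu hnu ha hmunu b20.
  have zmu0 r : r \in `[a, b] -> z r + mu != 0.
    by move=> /zmu ?; rewrite gt_eqF//; lra.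
  exists z; split; last exact: global_branch.
  split=> //; first by split=> //; exact: A1_continuous.
  move=> w _ _ ws r rab; apply: (inc_inj_in (f_cubic_inc_right hnu hmunu)).
  + rewrite inE/= ltNge; apply/negP => /(f_cubic_le_eta hnu hmunu).
    by rewrite ws// leNgt b2.
  + by rewrite inE; exact: zmu.
  + by rewrite zs ?ws.
- have b20 r : r \in `[a, b] -> 0 < beta_r alpha mu b tau r ^+ 2.
    by move=> /b2/andP[].
  have [z1 [z1c z1s z1I]] := right_solution halpha hmu hnu ha hmunu b20.
  have [z2 [z2c z2s z2I]] := middle_solution hnu ha hmunu b2.
  have [z3 [z3c z3s z3I]] := left_solution hnu ha hmunu b2.
  have z1mu r : r \in `[a, b] -> z1 r + mu != 0.
    by move=> /z1I ?; rewrite gt_eqF//; lra.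
  have z2mu r : r \in `[a, b] -> z2 r + mu != 0.
    by move=> /z2I ?; rewrite lt_eqF//; lra.
  have z3mu r : r \in `[a, b] -> z3 r + mu != 0.
    by move=> /z3I ?; rewrite lt_eqF//; lra.
  have [v1L v1min v1max v1eq] := global_branch ha hnu hmunu z1c z1s z1I.
  exists z1, z2, z3; split.
    split=> //.
    + by split; split=> //; exact: A1_continuous.
    + move=> r rab; have := z1I _ rab; have /andP[] := z2I _ rab.
      by have /andP[] := z3I _ rab; split.
    + move=> z zc _; apply: solution_trichotomy z1s z2s z3s z1I z2I _ zc => //.
      by move=> r /z3I/andP[].
  split=> //.
  + by split=> //; exact: vbar_L4.
  + exact: middle_branch z2s z3s z2I z3I.
  + exact: left_branch z2s z3s z2I z3I.
Qed.
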